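(* Let $M$ be a matroid of rank $r$ on ground set $[n]$ and let $H$ be a stressed hyperplane of $M$ with $|H|=s$. Then for every nonnegative integer $t$, \[ \mathrm{ehr}_{\mathrm{Rel}_H(M)}(t)=\mathrm{ehr}_{M}(t)+\sum_{m=0}^{t-1}\sum_{i=0}^{s-r}(-1)^i\binom{s}{i}\binom{t(s-r-i)+m+s-1-i}{s-1}\binom{m+n-s-1}{m}. \]
   Context: A hyperplane of a rank-$r$ matroid is a flat of rank $r-1$. A hyperplane $H$ is stressed if every subset of $H$ of size $r-1$ is independent. If $\mathcal{B}$ is the basis system of $M$ and $H$ is a stressed hyperplane, the relaxation $\mathrm{Rel}_H(M)$ is the matroid with basis system $\mathcal{B}\cup\binom{H}{r}$ (where $\binom{H}{r}$ is the family of $r$-subsets of $H$); this is a matroid. The base polytope of a matroid $M$ on $[n]$ is $\mathcal{P}_M=\mathrm{conv}\{\mathbf{e}_B: B \text{ a basis}\}\subset\mathbb{R}^n$, where $\mathbf{e}_B=\sum_{i\in B}\mathbf{e}_i$, and $\mathrm{ehr}_M(t)=|t\mathcal{P}_M\cap\mathbb{Z}^n|$ for nonnegative integers $t$. *)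

(* Defs.v *)
From HB Require Import structures.
From mathcomp Require Import all_boot all_order all_algebra.

Set Implicit Arguments.
Unset Strict Implicit.
Unset Printing Implicit Defensive.

Import Order.TTheory GRing.Theory Num.Theory.
Local Open Scope nat_scope.

Record matroid (n : nat) := Matroid {
  bases : {set {set 'I_n}};
  bases_neq0 : bases != set0;
  bases_exchange : forall (B1 B2 : {set 'I_n}) (x : 'I_n),
    B1 \in bases -> B2 \in bases -> x \in B1 :\: B2 ->
    exists2 y, y \in B2 :\: B1 & y |: (B1 :\ x) \in bases
}.

Definition indep n (M : matroid n) (I : {set 'I_n}) : bool :=
  [exists B in bases M, I \subset B].

Definition rk n (M : matroid n) (A : {set 'I_n}) : nat :=
  \max_(I : {set 'I_n} | (I \subset A) && indep M I) #|I|.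

Definition rank n (M : matroid n) : nat := rk M [set: 'I_n].

Definition flat n (M : matroid n) (F : {set 'I_n}) : bool :=
  [forall x, (x \notin F) ==> (rk M F < rk M (x |: F))].

(* Written with a successor so that a matroid of rank 0 has no hyperplane. *)
Definition hyperplane n (M : matroid n) (H : {set 'I_n}) : bool :=
  flat M H && ((rk M H).+1 == rank M).

Definition stressed n (M : matroid n) (H : {set 'I_n}) : bool :=
  [forall A : {set 'I_n},
    (A \subset H) && (#|A| == (rank M).-1) ==> indep M A].

Definition stressed_hyperplane n (M : matroid n) (H : {set 'I_n}) : bool :=
  hyperplane M H && stressed M H.

Definition relaxation_bases n (M : matroid n) (H : {set 'I_n}) :
    {set {set 'I_n}} :=
  bases M :|: [set A : {set 'I_n} | (A \subset H) && (#|A| == rank M)].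

Section MatroidFacts.
Variables (n : nat) (M : matroid n).
Implicit Types (A B I : {set 'I_n}).

Lemma card_swap B x y : x \in B -> y \notin B -> #|y |: (B :\ x)| = #|B|.
Proof.
move=> xB yB; rewrite cardsU1 !inE (negbTE yB) andbF add1n.
by rewrite [RHS](cardsD1 x) xB.
Qed.

Lemma bases_card_le k B1 B2 : B1 \in bases M -> B2 \in bases M ->
  #|B1 :\: B2| = k -> #|B1| <= #|B2|.
Proof.
elim: k B1 => [|k IH] B1 b1 b2 e.
  by apply: subset_leq_card; rewrite -setD_eq0 -cards_eq0 e.
have [x xD] : exists x, x \in B1 :\: B2 by apply/card_gt0P; rewrite e.
have [y] := bases_exchange b1 b2 xD.
move: (xD); rewrite !inE => /andP[x2 x1] /andP[y1 y2] b.
rewrite -(card_swap x1 y1); apply: IH => //.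
have -> : (y |: B1 :\ x) :\: B2 = (B1 :\: B2) :\ x.
  apply/setP => z; rewrite !inE.
  have [->|_] := eqVneq z y; first by rewrite y2 !andbF.
  by rewrite /= andbCA.
by apply: succn_inj; rewrite -e [RHS](cardsD1 x) xD.
Qed.

Lemma bases_card B1 B2 : B1 \in bases M -> B2 \in bases M -> #|B1| = #|B2|.
Proof.
move=> b1 b2; apply/eqP; rewrite eqn_leq.
by rewrite (bases_card_le b1 b2 erefl) (bases_card_le b2 b1 erefl).
Qed.

Lemma bases_indep B : B \in bases M -> indep M B.
Proof. by move=> b; apply/existsP; exists B; rewrite b /=. Qed.

Lemma rank_bases B : B \in bases M -> #|B| = rank M.
Proof.
move=> b; apply/eqP; rewrite eqn_leq; apply/andP; split.
  by rewrite /rank /rk (bigD1 B) /= ?leq_maxl // subsetT bases_indep.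
apply/bigmax_leqP => I /andP[_ /existsP[B' /andP[b' IB]]].
by rewrite (bases_card b b') subset_leq_card.
Qed.

Lemma rk_witness A : exists I, [/\ I \subset A, indep M I & #|I| = rk M A].
Proof.
have P0 : (set0 \subset A) && indep M set0.
  rewrite sub0set; have /set0Pn[B b] := bases_neq0 M.
  by apply/existsP; exists B; rewrite b sub0set.
have h : 0 < #|[pred I : {set 'I_n} | (I \subset A) && indep M I]|.
  by apply/card_gt0P; exists set0.
have [I /andP[IA iI] e] := eq_bigmax_cond (fun I : {set 'I_n} => #|I|) h.
by exists I; split.
Qed.

Lemma indep_le_rk I A : I \subset A -> indep M I -> #|I| <= rk M A.
Proof.
by move=> IA iI; rewrite /rk (bigD1 I) /= ?leq_maxl // IA.
Qed.

Lemma indep_aug I B : indep M I -> #|I|.+1 = rank M -> B \in bases M ->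
  exists2 y, y \in B :\: I & y |: I \in bases M.
Proof.
move=> /existsP[B' /andP[b' IB']] cI b.
have : #|B' :\: I| = 1%N.
  by rewrite cardsD (setIidPr IB') (rank_bases b') -cI subSnn.
move=> /eqP/cards1P[z ez].
have zD : z \in B' :\: I by rewrite ez inE.
have B'E : B' = z |: I by rewrite -ez -[LHS](setID B' I) (setIidPr IB') setUC.
have [zB|zB] := boolP (z \in B).
  exists z; last by rewrite -B'E.
  by move: zD; rewrite !inE zB => /andP[-> _].
have zD' : z \in B' :\: B by rewrite inE zB; move: zD; rewrite inE => /andP[_].
have [y yD yb] := bases_exchange b' b zD'.
have zI : z \notin I by move: zD; rewrite inE => /andP[].
have e : B' :\ z = I by rewrite B'E setU1K.
rewrite e in yb; exists y => //.
by move: yD; rewrite B'E !inE negb_or -andbA => /and3P[_ -> ->].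
Qed.

Variable H : {set 'I_n}.
Hypothesis hH : stressed_hyperplane M H.

Lemma relaxation_bases_neq0 : relaxation_bases M H != set0.
Proof.
have /set0Pn[B b] := bases_neq0 M.
by apply/set0Pn; exists B; rewrite !inE b.
Qed.

Lemma relaxation_card B : B \in relaxation_bases M H -> #|B| = rank M.
Proof. by rewrite !inE => /orP[/rank_bases|/andP[_ /eqP]]. Qed.

Lemma stressed_indep A : A \subset H -> #|A|.+1 = rank M -> indep M A.
Proof.
move=> AH cA; have /andP[_ /forallP/(_ A)/implyP] := hH; apply.
by rewrite AH -cA /=.
Qed.

Lemma hyperplane_aug I z : I \subset H -> #|I|.+1 = rank M -> z \notin H ->
  z |: I \in bases M.
Proof.
move=> IH cI zH; have /andP[/andP[/forallP/(_ z) fl /eqP rH] _] := hH.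
move: fl; rewrite zH implyTb -ltnS => lt.
have [J [Jz /existsP[B /andP[bB JB]] cJ]] := rk_witness (z |: H).
have JE : J = B.
  apply/eqP; rewrite eqEcard JB (rank_bases bB) cJ -rH; exact: lt.
have bJ : J \in bases M by rewrite JE.
have [y yJ yb] := indep_aug (stressed_indep IH cI) cI bJ.
suff <- : y = z by [].
have := subsetP Jz y; move: yJ; rewrite !inE => /andP[_ ->] /(_ isT).
case/orP=> [/eqP //|yH].
have sub : y |: I \subset H by rewrite subUset sub1set yH.
have := indep_le_rk sub (bases_indep yb).
by rewrite (rank_bases yb) -rH ltnn.
Qed.

Lemma relaxation_bases_exchange B1 B2 x :
  B1 \in relaxation_bases M H -> B2 \in relaxation_bases M H ->
  x \in B1 :\: B2 ->
  exists2 y, y \in B2 :\: B1 & y |: (B1 :\ x) \in relaxation_bases M H.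
Proof.
move=> r1 r2 xD.
have c1 := relaxation_card r1; have c2 := relaxation_card r2.
have [x2 x1] : x \notin B2 /\ x \in B1 by move: xD; rewrite inE => /andP.
have cD : #|B1 :\ x|.+1 = rank M by rewrite -c1 (cardsD1 x B1) x1.
have [y0 y0D] : exists y, y \in B2 :\: B1.
  apply/set0Pn; rewrite setD_eq0; apply/negP => s21.
  have e21 : B2 = B1 by apply/eqP; rewrite eqEcard s21 c1 c2 leqnn.
  by rewrite e21 x1 in x2.
have [b2|nb2] := boolP (B2 \in bases M).
  have aug : indep M (B1 :\ x) ->
      exists2 y, y \in B2 :\: B1 & y |: (B1 :\ x) \in relaxation_bases M H.
    move=> iD; have [y yD yb] := indep_aug iD cD b2.
    exists y; last by rewrite inE yb.
    move: yD; rewrite !inE; have [->|_] := eqVneq y x; last by [].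
    by rewrite (negbTE x2) andbF.
  apply: aug; move: r1; rewrite !inE => /orP[b1|/andP[s1 _]].
    by apply/existsP; exists B1; rewrite b1 subD1set.
  by apply: stressed_indep => //; apply: subset_trans s1; apply: subD1set.
have s2 : B2 \subset H by move: r2; rewrite !inE (negbTE nb2) => /andP[].
have [s1|] := boolP (B1 :\ x \subset H).
  exists y0 => //; move: y0D; rewrite !inE => /andP[y1 y2].
  apply/orP; right; rewrite card_swap // c1 eqxx andbT.
  by rewrite subUset sub1set (subsetP s2).
move=> /subsetPn[z zD zH].
have b1 : B1 \in bases M.
  move: r1; rewrite !inE => /orP[//|/andP[s1 _]].
  by move: zH; rewrite (subsetP s1) //; move: zD; rewrite inE => /andP[].
have y02 : y0 \in B2 by move: y0D; rewrite inE => /andP[].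
have sI : B2 :\ y0 \subset H by apply: subset_trans s2; apply: subD1set.
have cI : #|B2 :\ y0|.+1 = rank M by rewrite -c2 (cardsD1 y0 B2) y02.
have bI := hyperplane_aug sI cI zH.
have [zx zB1] : z != x /\ z \in B1 by move: zD; rewrite !inE => /andP.
have xI : x \in B1 :\: (z |: B2 :\ y0).
  by rewrite !inE x1 eq_sym (negbTE zx) (negbTE x2) /= andbF.
have [y yD yb] := bases_exchange b1 bI xI.
exists y; last by rewrite inE yb.
move: yD; rewrite !inE => /andP[y1 /orP[/eqP ey|/andP[_ ->]]]; last by rewrite y1.
by rewrite ey zB1 in y1.
Qed.

End MatroidFacts.

Definition relaxation n (M : matroid n) (H : {set 'I_n})
    (hH : stressed_hyperplane M H) : matroid n :=
  Matroid (relaxation_bases_neq0 M H) (@relaxation_bases_exchange n M H hH).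

From mathcomp Require Import finmap mathcomp_extra boolp classical_sets.
From mathcomp Require Import functions cardinality reals interval_inference convex.

Section BasePolytope.
Local Open Scope classical_set_scope.
Local Open Scope ring_scope.
Variables (R : realType) (n : nat) (M : matroid n).

Definition indicator_vec (B : {set 'I_n}) : 'rV[R]_n :=
  \sum_(i in B) delta_mx 0 i.

Definition convex_hull (X : set 'rV[R]_n) : set 'rV[R]_n :=
  smallest (@convex_set R 'rV[R]_n) X.

Definition base_polytope : set 'rV[R]_n :=
  convex_hull [set indicator_vec B | B in [set` bases M]].

Definition dilated_lattice_points (t : nat) : set 'rV[R]_n :=
  [set t%:R *: x | x in base_polytope] `&`
  [set x : 'rV[R]_n | forall i, x 0 i \is a Num.int].

Lemma indicator_vecE B i : indicator_vec B 0 i = (i \in B)%:R.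
Proof.
rewrite /indicator_vec summxE; under eq_bigr => j _ do rewrite mxE eqxx /=.
have [iB|iB] := boolP (i \in B).
  rewrite (bigD1 i) //= eqxx big1 ?addr0 // => j /andP[_ /negbTE ji].
  by rewrite eq_sym ji.
rewrite big1 // => j jB; case: eqVneq => // ij.
by rewrite ij jB in iB.
Qed.

Lemma base_polytope_cube x : base_polytope x -> forall i, 0 <= x 0 i <= 1.
Proof.
pose C : set 'rV[R]_n := [set x | forall i, 0 <= x 0 i <= 1].
suff : base_polytope `<=` C by move=> /(_ x)/[apply].
apply: smallest_sub => [|_ [B _ <-] i /=]; last first.
  by rewrite indicator_vecE; case: (i \in B); rewrite ?lexx ?ler01.
move=> a b l; rewrite !inE => aC bC i; rewrite !mxE.
have /andP[a0 a1] := aC i; have /andP[b0 b1] := bC i.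
have l0 : 0 <= l%:num by [].
have l1 : 0 <= 1 - l%:num by rewrite subr_ge0.
rewrite addr_ge0 ?mulr_ge0 //=.
have -> : 1 = l%:num * 1 + (1 - l%:num) * 1 :> R by rewrite !mulr1 addrC subrK.
by rewrite lerD // ler_wpM2l.
Qed.

Lemma finite_dilated_lattice_points t : finite_set (dilated_lattice_points t).
Proof.
pose g (f : {ffun 'I_n -> 'I_t.+1}) : 'rV[R]_n := \row_i (f i : nat)%:R.
apply: (@sub_finite_set _ _ (g @` setT)); last first.
  exact/finite_image/finite_finset.
move=> _ [[x /base_polytope_cube x01 <-] xZ].
have k i : exists k : 'I_t.+1, (t%:R *: x) 0 i = (k : nat)%:R.
  have /andP[x0 x1] := x01 i; have /intrP[z ez] := xZ i.
  have tx0 : 0 <= (t%:R *: x) 0 i by rewrite mxE mulr_ge0.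
  have txt : (t%:R *: x) 0 i <= t%:R by rewrite mxE ler_piMr.
  rewrite ez in tx0 txt *; case: z ez tx0 txt => [k|k] _; last first.
    by rewrite ler0z.
  move=> _; rewrite -pmulrn ler_nat -ltnS => kt.
  by exists (Ordinal kt).
exists [ffun i => sval (cid (k i))] => //.
by apply/rowP => i; rewrite [LHS]mxE ffunE; case: cid => j /= ->.
Qed.

(* fset_set would send an infinite set to the empty one; this never happens
   here by finite_dilated_lattice_points. *)
Definition ehr (t : nat) : nat := #|` fset_set (dilated_lattice_points t)|.

End BasePolytope.

(* Main.v *)
(* A point of the dilated base polytope tP of a matroid of rank r > 0 is a point
   of the cone over the bases with coordinate sum tr.  The points x of
   tP_Rel with x(H) <= t(r-1) are exactly the points of tP_M: by basis exchange,
   the segment from a base B of M to an r-subset C of H meets the level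
   x(H) = r-1 inside P_M, so the new bases can be absorbed by the bases of M with
   |B cap H| < r-1.  Every lattice point of [0,t]^n with sum tr and
   x(H) >= t(r-1) is a sum of t bases of Rel_H(M), because (r-1)-subsets of H can
   be completed by any element outside H.  Hence the difference of the two
   Ehrhart functions counts the lattice points of [0,t]^n with sum tr and
   x(H) = tr - m for some m < t; this is a product of two coefficients of powers
   of 1 + X + ... + X^t. *)
Require Import Defs.
From mathcomp Require Import finmap boolp classical_sets cardinality.
From mathcomp Require Import interval_inference convex.
From mathcomp Require Import all_boot all_order all_algebra reals.
From mathcomp Require Import zify ring lra.

Set Implicit Arguments.
Unset Strict Implicit.
Unset Printing Implicit Defensive.

Import Order.TTheory GRing.Theory Num.Theory.
Local Open Scope ring_scope.

(** * Coefficients of powers of [1 + X + ... + X^t], and lattice points in a slab of the cube *)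

(** Division by [(1 - X)^(k+1)] without power series: the inverse has coefficients ['C(a + k, k)].
    Dividing by one factor [1 - X] takes partial sums of coefficients, and Pascal's rule matches the
    binomials. *)
Lemma coef_div_1subX_exp (A : comNzRingType) (k : nat) (p q : {poly A}) :
  (1 - 'X) ^+ k.+1 * p = q ->
  forall a, p`_a = \sum_(j < a.+1) 'C(a - j + k, k)%:R * q`_j.
Proof.
have step (p' : {poly A}) a :
    p'`_a.+1 = p'`_a + ((1 - 'X) * p')`_a.+1 :> A.
  by rewrite mulrBl mul1r coefB coefXM /= addrC subrK.
elim: k p q => [|k IH] p q e a.
  under eq_bigr do rewrite bin0 mul1r.
  rewrite -e expr1.
  elim: a => [|a IHa].
    by rewrite big_ord1 mulrBl mul1r coefB coefXM /= subr0.
  by rewrite big_ord_recr /= -IHa step.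
have := IH ((1 - 'X) * p) q; rewrite mulrA -exprSr => /(_ e) {}IH.
elim: a => [|a IHa].
  have := IH 0%N; rewrite !big_ord1 /= subnn !add0n !binn mulrBl mul1r coefB.
  by rewrite coefXM /= subr0.
rewrite step IHa IH [RHS]big_ord_recr [in LHS](big_ord_recr a.+1) /=.
rewrite !subnn !add0n !binn addrA -big_split /=; congr (_ + _).
apply: eq_bigr => j _; rewrite -mulrDl -natrD.
have ja : (j <= a)%N by rewrite -ltnS.
by congr (_%:R * _); rewrite subSn // addSn -addnS [in RHS]addSn binS addnS.
Qed.

Lemma sumX_mul_1subX (A : comNzRingType) (t : nat) :
  (1 - 'X) * (\sum_(j < t.+1) 'X^j) = 1 - 'X ^+ t.+1 :> {poly A}.
Proof.
rewrite -{2}(expr1n _ t.+1) subrXX; congr (_ * _).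
by apply: eq_bigr => j _; rewrite expr1n mul1r.
Qed.

(** Multiplication by [(1 - X)^(k+1)] turns the power into [(1 - X^(t+1))^(k+1)], which the binomial
    theorem expands. The filter drops the terms of degree above [a], for which [a - i * t.+1] would
    be truncated. *)
Lemma coef_sumX_exp (t k a : nat) :
  ((\sum_(j < t.+1) 'X^j) ^+ k.+1 : {poly int})`_a =
  \sum_(0 <= i < k.+2 | (i * t.+1 <= a)%N)
     (-1) ^+ i * 'C(k.+1, i)%:Z * 'C(a - i * t.+1 + k, k)%:Z.
Proof.
rewrite (@coef_div_1subX_exp _ k _ ((1 - 'X ^+ t.+1) ^+ k.+1)); last first.
  by rewrite -exprMn sumX_mul_1subX.
rewrite exprBn.
under eq_bigr => j _ do rewrite coef_sum mulr_sumr.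
rewrite exchange_big /= [RHS]big_mkcond [RHS]big_mkord.
apply: eq_bigr => i _.
have E j :
    ((-1) ^+ i * 1 ^+ (k.+1 - i) * ('X ^+ t.+1) ^+ i *+ 'C(k.+1, i)
      : {poly int})`_j = (-1) ^+ i * 'C(k.+1, i)%:Z * (j == (i * t.+1)%N)%:R.
  have -> : (-1) ^+ i = ((-1) ^+ i)%:P :> {poly int} by rewrite rmorph_sign.
  rewrite expr1n mulr1 -exprM mulnC coefMn coefCM coefXn.
  by rewrite -mulrnAr -mulrA; congr (_ * _); rewrite -[LHS]mulr_natl natz.
under eq_bigr => j _ do rewrite E.
case: leqP => h.
  rewrite (bigD1 (Ordinal (h : i * t.+1 < a.+1)%N)) //= eqxx mulr1.
  rewrite big1 ?addr0; last first.
    by move=> j /negbTE jE; rewrite -val_eqE /= in jE; rewrite jE !mulr0.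
  by rewrite mulrC natz.
rewrite big1 // => j _.
have -> : (j == i * t.+1 :> nat)%N = false; last by rewrite !mulr0.
by have := ltn_ord j; lia.
Qed.

(* The exponents on H are t - f i, so that the complementary sum over H, and with
   it the formula, comes out without using the symmetry of the coefficients. *)
Lemma card_ffun_sums (T : finType) (t : nat) (H : {set T}) (a b : nat) :
  #|[set f : {ffun T -> 'I_t.+1} | (\sum_(i in H) (t - f i) == a)%N &&
      (\sum_(i in ~: H) f i == b)%N]|%:Z =
  ((\sum_(j < t.+1) 'X^j) ^+ #|H| : {poly int})`_a *
  ((\sum_(j < t.+1) 'X^j) ^+ #|~: H| : {poly int})`_b.
Proof.
set Q : {poly int} := \sum_(j < t.+1) 'X^j.
(* A bivariate generating function: the outer variable records the complementary sum over [H], the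
   inner one the sum outside [H]. *)
pose F (i : T) (j : 'I_t.+1) : {poly {poly int}} :=
  if i \in H then 'X^(t - j) else ('X^j)%:P.
have E : \prod_i \sum_j F i j = map_poly polyC (Q ^+ #|H|) * (Q ^+ #|~: H|)%:P.
  rewrite (bigID (mem H)) /=; congr (_ * _).
    rewrite (eq_bigr (fun=> map_poly polyC Q)); last first.
      move=> i iH; rewrite /Q rmorph_sum (reindex_inj rev_ord_inj) /=.
      apply: eq_bigr => j _; rewrite /F iH map_polyXn /=; congr ('X^ _).
      by have := ltn_ord j; lia.
    by rewrite prodr_const rmorphXn.
  rewrite (eq_bigr (fun=> Q%:P)); last first.
    move=> i iH; rewrite /Q rmorph_sum /=.
    by apply: eq_bigr => j _; rewrite /F (negbTE iH).
  rewrite prodr_const rmorphXn; congr (_ ^+ _).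
  by apply: eq_card => i; rewrite !inE.
have := congr1 (fun p : {poly {poly int}} => p`_a`_b) E.
rewrite coefMC coef_map coefCM => <-.
rewrite bigA_distr_bigA /= coef_sum coef_sum -sum1_card -[LHS]natz.
rewrite natr_sum big_mkcond /=; apply: eq_bigr => f _.
have -> : \prod_i F i (f i) =
    'X^(\sum_(i in H) (t - f i))%N * ('X^(\sum_(i in ~: H) f i)%N)%:P.
  rewrite (bigID (mem H)) /= -!prodrXr rmorph_prod; congr (_ * _).
    by apply: eq_bigr => i iH; rewrite /F iH.
  apply: eq_big => [i|i iH]; first by rewrite !inE.
  by rewrite /F (negbTE iH).
rewrite inE coefMC coefXn eq_sym; case: eqP => _ /=; last by rewrite mul0r coef0.
by rewrite mul1r coefXn eq_sym; case: eqP.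
Qed.

(** Let [m] be the sum of [f] outside [H]. The sum over [H] is then [t * r - m], its complement to
    [t * s] is [t * (s - r) + m], and the slab condition reads [m < t]. *)
Lemma card_ffun_slab (T : finType) (t r s : nat) (H : {set T}) :
    #|H| = s -> (0 < r <= s)%N ->
  #|[set f : {ffun T -> 'I_t.+1} | (\sum_i f i == t * r)%N &&
      (t * r.-1 < \sum_(i in H) f i)%N]| =
  (\sum_(m < t)
    #|[set f : {ffun T -> 'I_t.+1} |
        (\sum_(i in H) (t - f i) == t * (s - r) + m)%N &&
        (\sum_(i in ~: H) f i == m)%N]|)%N.
Proof.
move=> hs /andP[r0 rs].
under eq_bigr => m _ do rewrite -sum1_card big_mkcond.
rewrite exchange_big -sum1_card big_mkcond; apply: eq_bigr => f _ /=.
rewrite inE (bigID (mem H)) /=.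
have -> : (\sum_(i | i \notin H) f i = \sum_(i in ~: H) f i)%N.
  by apply: eq_bigl => i; rewrite inE.
set h := (\sum_(i in H) f i)%N; set b := (\sum_(i in ~: H) f i)%N.
have : (\sum_(i in H) (t - f i) + h = t * s)%N.
  rewrite -big_split /= (eq_bigr (fun=> t)) ?sum_nat_const ?hs ?(mulnC s) //.
  by move=> i _; rewrite subnK // -ltnS.
set a := (\sum_(i in H) _)%N => ah.
have es : (t * s = t * (s - r) + t * r)%N by rewrite -mulnDr subnK.
have er : (t * r = t * r.-1 + t)%N by rewrite -mulnSr prednK.
have [bt|tb] := ltnP b t; last first.
  rewrite big1; first by case: ifP => // /andP[/eqP e1 l1]; lia.
  move=> m _; rewrite inE -/b; case: ifP => // /andP[_ /eqP e].
  by have := ltn_ord m; lia.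
rewrite (bigD1 (Ordinal bt)) //= big1 ?addn0; last first.
  move=> m mb; rewrite inE -/b; case: ifP => // /andP[_ /eqP e].
  by move: mb; rewrite -val_eqE /= -e eqxx.
rewrite inE -/a -/b eqxx andbT; congr (nat_of_bool _).
lia.
Qed.

Lemma card_ffun_slab_formula (T : finType) (t r s : nat) (H : {set T}) :
    #|H| = s -> (0 < r <= s)%N -> (s < #|T|)%N ->
  #|[set f : {ffun T -> 'I_t.+1} | (\sum_i f i == t * r)%N &&
      (t * r.-1 < \sum_(i in H) f i)%N]|%:Z =
  \sum_(0 <= m < t) \sum_(0 <= i < (s.+1 - r)%N)
    (-1) ^+ i * 'C(s, i)%:Z
    * 'C(t * (s - r - i) + m + s - 1 - i, s - 1)%:Z
    * 'C(m + #|T| - s - 1, m)%:Z.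
Proof.
move=> hs rs sn; rewrite (card_ffun_slab _ hs rs) -[LHS]natz natr_sum big_mkord.
apply: eq_bigr => m _; rewrite natz card_ffun_sums -mulr_suml.
have cH : #|~: H| = (#|T| - s).-1.+1 by rewrite cardsCs setCK hs prednK ?subn_gt0.
have [r0 {}rs] := andP rs.
have s0 : s = s.-1.+1 by rewrite prednK // (leq_trans r0).
rewrite cH hs; congr (_ * _).
  rewrite {1}s0 coef_sumX_exp -s0.
  rewrite [RHS](big_nat_widen _ _ s.+1) ?leq_subr //.
  rewrite [LHS]big_nat_cond [RHS]big_nat_cond.
  rewrite [LHS]big_mkcond [RHS]big_mkcond; apply: eq_bigr => i _.
  have [il|il] := ltnP i s.+1; rewrite ?andbF ?andFb //= .
  have mt := ltn_ord m.
  (* For [i] above [s - r] the filter fails, since [m < t] gives [i * t.+1 > t * (s - r) + m]. *)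
  have [isr|isr] := ltnP i (s.+1 - r); rewrite ?andbT ?andbF; last first.
    case: ifP => // h; exfalso.
    have : ((s - r).+1 * t.+1 <= i * t.+1)%N by rewrite leq_mul2r; lia.
    by rewrite mulSnr [(t * _)%N]mulnC mulnS in h *; lia.
  have e : (t * (s - r) = t * (s - r - i) + t * i)%N.
    by rewrite -mulnDr subnK //; lia.
  rewrite mulnS subn1 [(i * t)%N]mulnC.
  case: leqP => h /=.
    by congr (_ * Posz 'C(_, _)); lia.
  (* Here [i <= s - r] but the filter fails: the upper index of the binomial drops below [s - 1], so
     the term of the formula vanishes too. *)
  by rewrite (@bin_small (_ - i)) ?mulr0 //; lia.
(* In the second factor [m < t.+1] leaves only the term [i = 0]. *)
rewrite coef_sumX_exp big_mkord (bigD1 ord0) //= big1 ?addr0; last first.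
  move=> i /andP[h i0]; exfalso; have mt := ltn_ord m.
  by case: i i0 h => -[|i] //= *; lia.
rewrite mul0n subn0 expr0 bin0 !mul1r.
have -> : (m + #|T| - s - 1 = m + (#|T| - s).-1)%N by lia.
by rewrite -(bin_sub (leq_addl m _)) addnK.
Qed.

Lemma exists_set_between (T : finType) (A B : {set T}) (k : nat) :
  A \subset B -> (#|A| <= k <= #|B|)%N ->
  exists C : {set T}, [/\ A \subset C, C \subset B & #|C| = k].
Proof.
move=> AB; elim: k => [|k IH] /andP[Ak kB].
  by exists A; split=> //; apply/eqP; rewrite -leqn0.
have [kA|kA] := ltnP k #|A|.
  by exists A; split=> //; apply/eqP; rewrite eqn_leq Ak.
have [|C [AC CB cC]] := IH; first by rewrite kA ltnW.
have /set0Pn[z] : B :\: C != set0.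
  by rewrite setD_eq0; apply/negP => /subset_leq_card; lia.
rewrite inE => /andP[zC zB]; exists (z |: C); split.
- exact: subset_trans AC (subsetUr _ _).
- by rewrite subUset sub1set zB.
- by rewrite cardsU1 zC cC.
Qed.

(** * The cone over the bases and its relation to the dilated base polytope *)

Section BaseCone.
Variables (R : realType) (n : nat).
Implicit Types (M : matroid n) (A B C : {set 'I_n}) (x y : 'rV[R]_n).

(** The weights are not normalised, so bases can be added and split off freely; the dilation factor
    is recovered from the coordinate sum. *)
Definition base_cone M x : Prop :=
  exists2 c : {set 'I_n} -> R, (forall B, 0 <= c B) &
    x = \sum_(B in bases M) c B *: indicator_vec R B.

Lemma base_coneD M x y : base_cone M x -> base_cone M y -> base_cone M (x + y).
Proof.
move=> [c c0 ->] [d d0 ->]; exists (fun B => c B + d B) => [B|].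
  by rewrite addr_ge0.
by rewrite -big_split; apply: eq_bigr => B _; rewrite scalerDl.
Qed.

Lemma base_coneZ M (a : R) x : 0 <= a -> base_cone M x -> base_cone M (a *: x).
Proof.
move=> a0 [c c0 ->]; exists (fun B => a * c B) => [B|]; first exact: mulr_ge0.
by rewrite scaler_sumr; apply: eq_bigr => B _; rewrite scalerA.
Qed.

Lemma base_cone0 M : base_cone M 0.
Proof. by exists (fun=> 0) => //; rewrite big1 // => B _; rewrite scale0r. Qed.

Lemma base_cone_sum M (I : Type) (s : seq I) (P : pred I) (F : I -> 'rV[R]_n) :
  (forall i, P i -> base_cone M (F i)) ->
  base_cone M (\sum_(i <- s | P i) F i).
Proof. by move=> h; apply: big_ind h; [exact: base_cone0|exact: base_coneD]. Qed.

Lemma base_cone_base M B : B \in bases M -> base_cone M (indicator_vec R B).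
Proof.
move=> b; exists (fun A => (A == B)%:R) => //.
rewrite (bigD1 B) //= eqxx scale1r big1 ?addr0 // => A /andP[_ /negbTE ->].
by rewrite scale0r.
Qed.

Lemma sum_indicator_vec A B :
  \sum_(i in A) indicator_vec R B 0 i = #|B :&: A|%:R.
Proof.
under eq_bigr do rewrite indicator_vecE.
rewrite -natr_sum -sum1_card; congr _%:R.
rewrite big_mkcond [RHS]big_mkcond; apply: eq_bigr => i _.
by rewrite inE andbC; case: (i \in A); case: (i \in B).
Qed.

Lemma sum_base_combination M (c : {set 'I_n} -> R) A :
  \sum_(i in A) (\sum_(B in bases M) c B *: indicator_vec R B) 0 i =
  \sum_(B in bases M) c B * #|B :&: A|%:R.
Proof.
under eq_bigr do rewrite summxE.
rewrite exchange_big; apply: eq_bigr => B _.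
by rewrite -sum_indicator_vec mulr_sumr; apply: eq_bigr => i _; rewrite mxE.
Qed.

Lemma sum_base_combinationT M (c : {set 'I_n} -> R) :
  \sum_i (\sum_(B in bases M) c B *: indicator_vec R B) 0 i =
  (\sum_(B in bases M) c B) * (rank M)%:R.
Proof.
have := sum_base_combination M c [set: 'I_n].
under eq_bigl do rewrite inE; move=> ->; rewrite mulr_suml.
by apply: eq_bigr => B b; rewrite setIT (rank_bases b).
Qed.

(** Passes from binary to finite combinations, by merging one term at a time. The total weight may
    be 0, and then [x0] serves as the witness. *)
Lemma convex_set_combination (X : set 'rV[R]_n) (I : Type) (s : seq I)
    (P : pred I) (c : I -> R) (v : I -> 'rV[R]_n) (x0 : 'rV[R]_n) :
    convex_set X -> X x0 ->
    (forall i, P i -> 0 <= c i) -> (forall i, P i -> X (v i)) ->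
  exists2 x, X x & \sum_(i <- s | P i) c i *: v i = (\sum_(i <- s | P i) c i) *: x.
Proof.
move=> cX Xx0 c0 Xv; elim: s => [|i s [x Xx IH]].
  by exists x0 => //; rewrite !big_nil scale0r.
rewrite !big_cons; case: ifPn => Pi; last by exists x.
rewrite IH; set S := \sum_(j <- s | P j) c j.
have S0 : 0 <= S by apply: sumr_ge0.
have ci := c0 i Pi.
have [T0|T0] := eqVneq (c i + S) 0.
  have -> : c i = 0 by lra.
  have -> : S = 0 by lra.
  by exists x0; rewrite // !scale0r addr0 addr0 scale0r.
have Tp : 0 < c i + S by rewrite lt_neqAle eq_sym T0 addr_ge0.
have l0 : 0 <= c i / (c i + S) by rewrite divr_ge0 // ltW.
have l1 : c i / (c i + S) <= 1 by rewrite ler_pdivrMr // mul1r; lra.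
have := cX (v i) x (Itv01 l0 l1); rewrite !in_setE => /(_ (Xv i Pi) Xx) Xc.
pose l := c i / (c i + S); exists (l *: v i + (1 - l) *: x); first exact: Xc.
by rewrite scalerDr !scalerA; congr (_ *: _ + _ *: _); rewrite /l; field.
Qed.

(** Forward, the convex combinations of base vectors form a convex set containing these vectors,
    hence contain the hull. Backward, every base vector has coordinate sum [rank M > 0], so the
    coordinate sum forces total weight [t]. *)
Lemma dilate_base_polytopeP M (t : nat) y : (0 < rank M)%N ->
  (exists2 x, base_polytope M x & t%:R *: x = y) <->
  base_cone M y /\ \sum_i y 0 i = (t * rank M)%:R.
Proof.
move=> r0; split=> [[x Px <-]|].
  suff [c c0 [c1 ->]] : exists2 c : {set 'I_n} -> R, (forall B, 0 <= c B) &
      \sum_(B in bases M) c B = 1 /\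
      x = \sum_(B in bases M) c B *: indicator_vec R B.
    split; first by apply: base_coneZ => //; exists c.
    under eq_bigr do rewrite mxE.
    by rewrite -mulr_sumr sum_base_combinationT c1 mul1r natrM.
  pose X : set 'rV[R]_n := [set x | exists2 c : {set 'I_n} -> R,
      (forall B, 0 <= c B) & \sum_(B in bases M) c B = 1 /\
      x = \sum_(B in bases M) c B *: indicator_vec R B]%classic.
  apply: (Px X); split=> [|_ [B b <-]].
    move=> a b l; rewrite !in_setE => -[c c0 [c1 ->]] [d d0 [d1 ->]].
    have l0 : 0 <= l%:num by [].
    have l1 : 0 <= 1 - l%:num by rewrite subr_ge0.
    exists (fun B => l%:num * c B + (1 - l%:num) * d B) => [B|].
      by rewrite addr_ge0 ?mulr_ge0.
    split; first by rewrite big_split /= -!mulr_sumr c1 d1; ring.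
    under [RHS]eq_bigr do rewrite scalerDl -!scalerA.
    by rewrite big_split /= -!scaler_sumr.
  exists (fun A => (A == B)%:R) => //; split.
    by rewrite (bigD1 B) //= eqxx big1 ?addr0 // => A /andP[_ /negbTE ->].
  rewrite (bigD1 B) //= eqxx scale1r big1 ?addr0 // => A /andP[_ /negbTE ->].
  by rewrite scale0r.
move=> [[c c0 ->]]; rewrite sum_base_combinationT natrM => e.
have {}e : \sum_(B in bases M) c B = t%:R.
  by apply: mulIf e; rewrite pnatr_eq0 -lt0n.
have /set0Pn[B0 b0] := bases_neq0 M.
have sub B : B \in bases M -> base_polytope M (indicator_vec R B).
  by move=> b X [_]; apply; exists B.
have cP : convex_set (@base_polytope R n M).
  move=> a b l; rewrite !in_setE => Pa Pb X XX; have [cX _] := XX.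
  have := cX a b l; rewrite !in_setE; apply; [exact: Pa|exact: Pb].
have [x Px ex] := convex_set_combination (index_enum {set 'I_n}) cP
  (sub _ b0) (fun B _ => c0 B) sub.
by exists x => //; rewrite -e -ex.
Qed.
End BaseCone.

(** * The cones of [M] and of its relaxation, compared by the coordinate sum over [H] *)

Section RelaxationCone.
Variables (R : realType) (n : nat) (M : matroid n) (H : {set 'I_n}).
Hypothesis hH : stressed_hyperplane M H.
Implicit Types (A B C : {set 'I_n}) (x y : 'rV[R]_n).

Lemma rank_stressed_gt0 : (0 < rank M)%N.
Proof. by have /andP[/andP[_ /eqP <-] _] := hH. Qed.

Lemma card_base_cap B : B \in bases M -> (#|B :&: H| <= (rank M).-1)%N.
Proof.
move=> b; have /andP[/andP[_ /eqP <-] _] := hH.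
apply: indep_le_rk; first exact: subsetIr.
by apply/existsP; exists B; rewrite b subsetIl.
Qed.

Lemma card_stressed_ge : ((rank M).-1 <= #|H|)%N.
Proof.
have /andP[/andP[_ /eqP <-] _] := hH; have [I [IH _ <-]] := rk_witness M H.
exact: subset_leq_card.
Qed.

Lemma card_stressed_lt : (#|H| < n)%N.
Proof.
rewrite -[n in (_ < n)%N]card_ord -cardsT proper_card // properT.
apply/eqP => HT; have /andP[/andP[_ /eqP e] _] := hH.
by move: e; rewrite HT => /esym/n_Sn.
Qed.

Lemma indicator_vec_exchange B C b c :
  b \in B -> c \notin B -> c \in C -> b \notin C ->
  indicator_vec R B + indicator_vec R C =
  indicator_vec R (c |: B :\ b) + indicator_vec R (b |: C :\ c).
Proof.
move=> bB cB cC bC; apply/rowP => i; rewrite !mxE !indicator_vecE !inE.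
have [->|ic] := eqVneq i c.
  by rewrite (negbTE cB) cC (negbTE (memPn bC _ cC)) //= addrC.
have [->|ib] := eqVneq i b; first by rewrite bB (negbTE bC) addrC.
by [].
Qed.

(** Induction on the deficiency [d]. One copy of [C] is used up by swapping some [b] in [B] outside
    [H] with some [y] in [C]: the set got from [B] gains an element of [H], and the one got from [C]
    is a base of [M] because [b] is outside [H]. *)
Lemma base_cone_level (d : nat) B C :
    B \in bases M -> C \subset H -> #|C| = rank M ->
    (#|B :&: H| + d = (rank M).-1)%N ->
  base_cone M (indicator_vec R B + d%:R *: indicator_vec R C).
Proof.
have r0 := rank_stressed_gt0.
elim: d B => [|d IH] B bB CH cC e.
  by rewrite scale0r addr0; apply: base_cone_base.
have /subsetPn[b b1 bH] : ~~ (B \subset H).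
  by apply/negP => /setIidPl BH; rewrite BH (rank_bases bB) in e; lia.
have bC : b \notin C by apply: contra bH; apply: subsetP.
have rB : B \in relaxation_bases M H by rewrite inE bB.
have rC : C \in relaxation_bases M H by rewrite !inE CH cC eqxx orbT.
have [|y] := relaxation_bases_exchange hH rB rC (x := b); first by rewrite inE bC.
rewrite inE => /andP[yB yC] rB'.
have yH := subsetP CH _ yC.
have cB' : #|(y |: B :\ b) :&: H| = #|B :&: H|.+1.
  have -> : (y |: B :\ b) :&: H = y |: (B :&: H).
    apply/setP => i; rewrite !inE; case: eqVneq => [->|_] //=.
    by case: eqVneq => [->|_] //; rewrite (negbTE bH) !andbF.
  by rewrite cardsU1 inE (negbTE yB).
(* A new base of the relaxation would lie in [H], forcing [B] to meet [H] in [r - 1] elements, while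
   [e] leaves it [d.+1] short of that. *)
have bB' : y |: B :\ b \in bases M.
  move: rB'; rewrite !inE => /orP[//|/andP[sH /eqP c]].
  move: cB'; rewrite (setIidPl sH) c => rE; move: e; rewrite rE /= => /eqP.
  by rewrite -[X in _ == X]addn0 eqn_add2l.
have bC' : b |: C :\ y \in bases M.
  apply: hyperplane_aug bH => //; first exact: subset_trans (subD1set _ _) CH.
  by rewrite -cC (cardsD1 y C) yC.
rewrite mulrS scalerDl scale1r addrA (indicator_vec_exchange b1 yB yC bC).
rewrite addrAC; apply: base_coneD (base_cone_base R bC').
by apply: IH => //; rewrite cB' -e addSnnS.
Qed.

(** The point lies on the segment between the cases of multiplicity 0 and maximal multiplicity of
    [C]. *)
Lemma base_cone_level_le B C (u : R) :
    B \in bases M -> C \subset H -> #|C| = rank M ->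
    0 <= u <= ((rank M).-1 - #|B :&: H|)%:R ->
  base_cone M (indicator_vec R B + u *: indicator_vec R C).
Proof.
move=> bB CH cC; have lB := card_base_cap bB.
set d := (_ - _)%N => /andP[u0 ud].
have [d0|dp] := posnP d.
  have -> : u = 0 by apply/eqP; rewrite eq_le u0 andbT; rewrite d0 in ud.
  by rewrite scale0r addr0; apply: base_cone_base.
have dR : 0 < d%:R :> R by rewrite ltr0n.
have -> : indicator_vec R B + u *: indicator_vec R C =
    (1 - u / d%:R) *: indicator_vec R B +
    (u / d%:R) *: (indicator_vec R B + d%:R *: indicator_vec R C).
  rewrite scalerDr addrA -scalerDl subrK scale1r scalerA divfK //.
  by rewrite gt_eqF.
apply: base_coneD; apply: base_coneZ.
- by rewrite subr_ge0 ler_pdivrMr // mul1r.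
- exact: base_cone_base.
- by rewrite divr_ge0 // ltW.
- by apply: base_cone_level => //; rewrite subnKC.
Qed.

Lemma sum_base_cone_le x (t : R) :
    base_cone M x -> \sum_i x 0 i = t * (rank M)%:R ->
  \sum_(i in H) x 0 i <= t * ((rank M).-1)%:R.
Proof.
have r0 := rank_stressed_gt0.
move=> [c c0 ->]; rewrite sum_base_combinationT sum_base_combination.
move/mulIf => <-; last by rewrite pnatr_eq0 -lt0n.
rewrite mulr_suml; apply: ler_sum => B b.
by rewrite ler_wpM2l // ler_nat card_base_cap.
Qed.

Lemma base_cone_relaxation x : base_cone M x -> base_cone (relaxation hH) x.
Proof.
move=> [c c0 ->]; apply: base_cone_sum => B b; apply: base_coneZ => //.
by apply: base_cone_base; rewrite /= inE b.
Qed.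

Lemma rank_relaxation : rank (relaxation hH) = rank M.
Proof.
have /set0Pn[B b] := bases_neq0 (relaxation hH).
by rewrite -(rank_bases b); apply: relaxation_card b.
Qed.

(* Each mass c C outside M is spread over the bases B of M in proportion to
   their total deficiency c B * d B; the hypothesis on x(H) says that the total
   deficiency D is at least the total mass L to be absorbed. *)
Lemma relaxation_base_cone x (t : R) :
    base_cone (relaxation hH) x -> \sum_i x 0 i = t * (rank M)%:R ->
    \sum_(i in H) x 0 i <= t * ((rank M).-1)%:R ->
  base_cone M x.
Proof.
have r0 := rank_stressed_gt0.
move=> [c c0 ->]; rewrite sum_base_combinationT rank_relaxation.
move/mulIf => <-; last by rewrite pnatr_eq0 -lt0n.
rewrite sum_base_combination.
pose N := [set A in relaxation_bases M H | A \notin bases M].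
have NP C : C \in N -> C \subset H /\ #|C| = rank M.
  by rewrite !inE => /andP[/orP[->//|/andP[-> /eqP]]].
have split_sum (V : zmodType) (F : {set 'I_n} -> V) :
    \sum_(B in bases (relaxation hH)) F B =
    \sum_(B in bases M) F B + \sum_(B in N) F B.
  rewrite (bigID (mem (bases M))) /=; congr (_ + _); apply: eq_bigl => B.
    by rewrite inE andbC; case: (_ \in bases M).
  by rewrite [in RHS]inE.
rewrite !split_sum.
pose d B := ((rank M).-1 - #|B :&: H|)%N.
set L := \sum_(C in N) c C; pose D := \sum_(B in bases M) c B * (d B)%:R.
have -> : \sum_(C in N) c C * #|C :&: H|%:R = L * (rank M)%:R.
  by rewrite mulr_suml; apply: eq_bigr => C /NP[/setIidPl -> ->].
have eD : (\sum_(B in bases M) c B) * (rank M).-1%:R =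
    \sum_(B in bases M) c B * #|B :&: H|%:R + D.
  rewrite mulr_suml -big_split /=; apply: eq_bigr => B b.
  by rewrite -mulrDr -natrD subnKC // card_base_cap.
have er : (rank M)%:R = (rank M).-1%:R + 1 :> R.
  by rewrite -[in LHS](prednK r0) -natr1.
(* After this [le] compares [L * r] with [D + L * (r - 1)], up to a common summand. *)
rewrite mulrDl eD er => le.
have {le} LD : L <= D by lra.
have L0 : 0 <= L by apply: sumr_ge0.
have [Lz|Ln] := eqVneq L 0.
  rewrite [X in _ + X]big1 ?addr0.
    by apply: base_cone_sum => B b; apply/base_coneZ/base_cone_base.
  move=> C CN; suff -> : c C = 0 by rewrite scale0r.
  exact: (psumr_eq0P (fun A _ => c0 A) Lz).
have Lp : 0 < L by rewrite lt_neqAle eq_sym Ln.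
have Dp : 0 < D by apply: lt_le_trans LD.
(* The pair [(B, C)] gets weight [c B * (c C / L)], and [L <= D] keeps the multiplicity of [C] at
   most [d B]. Summing over [C] gives back [c B]; summing over [B], with [D] the sum of the
   [c B * d B], gives back [c C]. *)
suff -> : \sum_(B in bases M) c B *: indicator_vec R B +
      \sum_(C in N) c C *: indicator_vec R C =
    \sum_(B in bases M) \sum_(C in N) (c B * (c C / L)) *:
      (indicator_vec R B + ((d B)%:R * (L / D)) *: indicator_vec R C).
  apply: base_cone_sum => B b; apply: base_cone_sum => C /NP[CH cC].
  apply: base_coneZ; first by rewrite mulr_ge0 ?divr_ge0.
  apply: base_cone_level_le => //; rewrite mulr_ge0 ?divr_ge0 //=; last exact: ltW.
  by rewrite ler_piMr // ler_pdivrMr // mul1r.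
under [RHS]eq_bigr do (under eq_bigr do rewrite scalerDr; rewrite big_split /=).
rewrite big_split /=; congr (_ + _).
  apply: eq_bigr => B b; rewrite -scaler_suml -mulr_sumr -mulr_suml.
  by rewrite divff // mulr1.
rewrite exchange_big; apply: eq_bigr => C CN.
under [RHS]eq_bigr do rewrite scalerA.
rewrite -scaler_suml; congr (_ *: _).
transitivity (D * (c C / D)); first by field; rewrite gt_eqF.
rewrite mulr_suml; apply: eq_bigr => B b.
by field; rewrite !gt_eqF.
Qed.

(* Induction on t: subtract a base containing every i in H with y i = t.+1 and
   avoiding the zeros of y; it lies in H if y(H) = t.+1 * r and otherwise has
   r - 1 elements in H. *)
Lemma stressed_slab_cone (t : nat) (y : 'I_n -> nat) :
    (forall i, i \in H -> y i <= t)%N ->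
    (\sum_i y i = t * rank M)%N ->
    (t * (rank M).-1 <= \sum_(i in H) y i)%N ->
  base_cone (relaxation hH) (\row_i (y i)%:R : 'rV[R]_n).
Proof.
have r0 := rank_stressed_gt0.
elim: t y => [|t IH] y yt yT yH.
  move/eqP: yT; rewrite mul0n sum_nat_eq0 => /forallP yT.
  suff -> : \row_i (y i)%:R = 0 :> 'rV[R]_n by apply: base_cone0.
  by apply/rowP => i; rewrite !mxE; have := yT i => /= /eqP ->.
have step A (y' := fun i => (y i - (i \in A))%N) :
    A \in bases (relaxation hH) -> (forall i, i \in A -> 0 < y i)%N ->
    (forall i, i \in H -> y i = t.+1 -> i \in A) ->
    (t * (rank M).-1 + #|A :&: H| <= \sum_(i in H) y i)%N ->
    base_cone (relaxation hH) (\row_i (y i)%:R : 'rV[R]_n).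
  move=> bA A0 Af AH.
  have ey : \row_i (y i)%:R = indicator_vec R A + \row_i (y' i)%:R.
    apply/rowP => i; rewrite !mxE indicator_vecE -natrD /y' subnKC //.
    by have := A0 i; case: (i \in A) => //; apply.
  have sy' (S : {set 'I_n}) :
      (\sum_(i in S) y' i + #|A :&: S| = \sum_(i in S) y i)%N.
    have -> : #|A :&: S| = (\sum_(i in S) (i \in A : nat))%N.
      rewrite -sum1_card big_mkcond [RHS]big_mkcond; apply: eq_bigr => i _.
      by rewrite inE; case: (i \in A); case: (i \in S).
    rewrite -big_split; apply: eq_bigr => i _; rewrite /y' /= subnK //.
    by have := A0 i; case: (i \in A) => //; apply.
  rewrite ey; apply: base_coneD (base_cone_base _ bA) _; apply: IH.
  - move=> i iH; rewrite /y'; have := yt i iH; rewrite leq_eqVlt => /orP[/eqP e|].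
      by rewrite (Af i iH e) e subn1.
    by rewrite ltnS => le; apply: leq_trans le; apply: leq_subr.
  - have := sy' [set: 'I_n]; rewrite setIT (rank_bases bA) rank_relaxation.
    have sT (F : 'I_n -> nat) : (\sum_(i in [set: 'I_n]) F i = \sum_i F i)%N.
      by apply: eq_bigl => i; rewrite inE.
    by rewrite !sT yT mulSn addnC => /addnI.
  - by rewrite -(leq_add2r #|A :&: H|) sy'.
(* The part in [H] of the base to subtract must contain [full] and lie in [supp]. The next bounds
   place [\sum_(i in H) y i] between [t.+1] times the two cardinals. *)
pose full := [set i in H | y i == t.+1]; pose supp := [set i in H | 0 < y i]%N.
have fs : full \subset supp.
  by apply/subsetP => i; rewrite !inE => /andP[-> /eqP ->].
have full_le : (#|full| * t.+1 <= \sum_(i in H) y i)%N.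
  rewrite -sum_nat_const big_mkcond [leqRHS]big_mkcond; apply: leq_sum => i _.
  by rewrite inE; case: (i \in H) => //=; case: eqP => [->|].
have supp_ge : (\sum_(i in H) y i <= #|supp| * t.+1)%N.
  rewrite -sum_nat_const big_mkcond [leqRHS]big_mkcond; apply: leq_sum => i _.
  rewrite inE; have := yt i; case: (i \in H) => //= /(_ isT).
  by case: (y i).
have sH : (\sum_(i in H) y i <= t.+1 * rank M)%N.
  by rewrite -yT [leqRHS](bigID (mem H)) leq_addr.
have between k : (#|full| <= k <= #|supp|)%N -> exists A : {set 'I_n},
    [/\ A \subset H, #|A| = k, (forall i, i \in A -> 0 < y i)%N &
      (forall i, i \in H -> y i = t.+1 -> i \in A)].
  move=> /(exists_set_between fs)[A [fA As cA]]; exists A; split=> //.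
  - by apply: subset_trans As _; apply/subsetP => i; rewrite inE => /andP[].
  - by move=> i /(subsetP As); rewrite inE => /andP[].
  - by move=> i iH e; apply: (subsetP fA); rewrite inE iH e eqxx.
move: sH; rewrite leq_eqVlt => /orP[/eqP eH|ltH].
  have [|A [AH cA A0 Af]] := between (rank M).
    by apply/andP; split; rewrite -(leq_pmul2r (ltn0Sn t)); lia.
  apply: (step A) => //; first by rewrite /= !inE AH cA eqxx orbT.
  rewrite (setIidPl AH) cA eH mulSn addnC leq_add2l.
  by rewrite leq_mul2l leq_pred orbT.
(* Strict inequality gives [#|full| < r], and [yH] gives [#|supp| >= r - 1]. *)
have [|A [AH cA A0 Af]] := between (rank M).-1.
  apply/andP; split; last by rewrite -(leq_pmul2r (ltn0Sn t)); lia.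
  by rewrite -ltnS prednK // -(ltn_pmul2r (ltn0Sn t)); lia.
(* The total of [y] exceeds its sum over [H], so some coordinate outside [H] is positive; its index
   completes [A] to a base. *)
have [z zH yz] : exists2 z, z \notin H & (0 < y z)%N.
  apply/exists_inP; apply: contraTT ltH => /exists_inPn h.
  rewrite -leqNgt -yT (bigID (mem H)) /= [X in (_ + X)%N]big1 ?addn0 //.
  by move=> i iH; apply/eqP; rewrite -leqn0 leqNgt; exact: h.
apply: (step (z |: A)).
- by rewrite /= inE (hyperplane_aug hH) // cA prednK.
- by move=> i; rewrite !inE => /orP[/eqP ->|/A0].
- by move=> i iH e; rewrite !inE Af ?orbT.
- have -> : (z |: A) :&: H = A.
    apply/setP => i; rewrite !inE; case: eqVneq => [->|_] /=.
      by rewrite (negbTE zH); apply/esym/negbTE; apply: contra zH; apply: subsetP.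
    by apply: andb_idr => iA; apply: (subsetP AH).
  by rewrite cA; move: yH; rewrite mulSn addnC.
Qed.
End RelaxationCone.

(** * Ehrhart functions as cardinals of finite sets of functions *)

Section EhrCount.
Variables (R : realType) (n : nat).

Definition row_of_ffun (t : nat) (f : {ffun 'I_n -> 'I_t.+1}) : 'rV[R]_n :=
  \row_i (f i : nat)%:R.

Lemma row_of_ffun_inj t : injective (@row_of_ffun t).
Proof.
move=> f g /rowP e; apply/ffunP => i; apply/val_inj/eqP.
by have := e i; rewrite !mxE => /eqP; rewrite eqr_nat.
Qed.

Lemma sum_row_of_ffun t (f : {ffun 'I_n -> 'I_t.+1}) (P : pred 'I_n) :
  \sum_(i | P i) row_of_ffun f 0 i = (\sum_(i | P i) f i)%N%:R.
Proof. by rewrite natr_sum; apply: eq_bigr => i _; rewrite mxE. Qed.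

Lemma dilated_lattice_points_ffun (M : matroid n) (t : nat) (y : 'rV[R]_n) :
  dilated_lattice_points M t y ->
  exists f : {ffun 'I_n -> 'I_t.+1}, y = row_of_ffun f.
Proof.
move=> [[x /base_polytope_cube x01 <-] xZ].
have k i : exists k : 'I_t.+1, (t%:R *: x) 0 i == (k : nat)%:R.
  have /andP[x0 x1] := x01 i.
  have : (t%:R *: x) 0 i \is a Num.nat by rewrite natrEint xZ mxE mulr_ge0.
  move=> /natrP[z ez]; have : (z%:R : R) <= t%:R by rewrite -ez mxE ler_piMr.
  by rewrite ler_nat -ltnS => zt; exists (Ordinal zt); rewrite ez.
exists [ffun i => xchoose (k i)]; apply/rowP => i.
by rewrite [RHS]mxE ffunE; apply/eqP/(xchooseP (k i)).
Qed.

Lemma ehr_card (M : matroid n) (t : nat) : (0 < rank M)%N ->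
  ehr R M t = #|[set f : {ffun 'I_n -> 'I_t.+1} |
    `[< base_cone M (row_of_ffun f) >] && (\sum_i f i == t * rank M)%N]|.
Proof.
move=> r0; set S := [set f | _].
have E : fset_set (@dilated_lattice_points R n M t) =
    [fset row_of_ffun f | f in S]%fset.
  apply/fsetP => y; rewrite in_fset_set; last exact: finite_dilated_lattice_points.
  apply/idP/imfsetP => [|[f /= fS ->]].
    rewrite in_setE => yD; have [f ef] := dilated_lattice_points_ffun yD.
    exists f => //=; rewrite inE; apply/andP.
    have [/(dilate_base_polytopeP _ _ r0)[yc ys] _] := yD.
    split; first by apply/asboolP; rewrite -ef.
    by rewrite -(eqr_nat R) -ys ef sum_row_of_ffun.
  rewrite in_setE; move: fS; rewrite inE => /andP[/asboolP fc /eqP fs]; split.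
    by apply/(dilate_base_polytopeP _ _ r0); rewrite sum_row_of_ffun fs.
  by move=> i; rewrite mxE natr_int.
by rewrite /ehr E card_imfset //=; [rewrite -cardE|exact: row_of_ffun_inj].
Qed.

(** Points are split by whether their sum over [H] exceeds [t * (r - 1)]. Those that do not are the
    points counted for [M]; those that do all lie in the cone of the relaxation. *)
Lemma ehr_relaxation (M : matroid n) (H : {set 'I_n})
    (hH : stressed_hyperplane M H) (t : nat) :
  ehr R (relaxation hH) t = (ehr R M t +
    #|[set f : {ffun 'I_n -> 'I_t.+1} | (\sum_i f i == t * rank M)%N &&
      (t * (rank M).-1 < \sum_(i in H) f i)%N]|)%N.
Proof.
have r0 := rank_stressed_gt0 hH.
rewrite !ehr_card ?rank_relaxation //.
set T := [set f | _ && (_ < _)%N]; set S := [set f | _].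
rewrite -(cardsID T S) addnC; congr (_ + _)%N; apply: eq_card => f.
  rewrite !inE; case: eqP => [fs|]; rewrite ?andbF ?andbT //.
  have fsR : \sum_i row_of_ffun f 0 i = t%:R * (rank M)%:R.
    by rewrite sum_row_of_ffun fs natrM.
  rewrite -leqNgt; apply/andP/asboolP => [[le /asboolP fc]|fc].
    apply: relaxation_base_cone fc fsR _.
    by rewrite sum_row_of_ffun -natrM ler_nat.
  split; last by apply/asboolP/base_cone_relaxation.
  have := sum_base_cone_le hH fc fsR.
  by rewrite sum_row_of_ffun -natrM ler_nat.
rewrite !inE; case: eqP => [fs|]; rewrite ?andbF ?andbT //=.
apply: andb_idl => lt; apply/asboolP.
apply: (stressed_slab_cone _ hH (t := t)) => [i _||]; last exact: ltnW.
  by rewrite -ltnS.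
exact: fs.
Qed.
End EhrCount.

(* The range i < s.+1 - r is 0 <= i <= s - r, and it is empty when s = r - 1.
   Inside the range r <= s < n and 0 < r, so no subtraction of naturals is
   truncated. *)
Theorem theorem5p7 (R : realType) (n r s : nat) (M : matroid n)
    (H : {set 'I_n}) (hr : rank M = r) (hH : stressed_hyperplane M H)
    (hs : #|H| = s) (t : nat) :
  (ehr R (relaxation hH) t)%:Z =
  (ehr R M t)%:Z +
  \sum_(0 <= m < t) \sum_(0 <= i < (s.+1 - r)%N)
    (-1) ^+ i * 'C(s, i)%:Z
    * 'C(t * (s - r - i) + m + s - 1 - i, s - 1)%:Z
    * 'C(m + n - s - 1, m)%:Z.
Proof.
have r0 := rank_stressed_gt0 hH; have sn := card_stressed_lt hH.
rewrite ehr_relaxation PoszD; congr (_ + _); rewrite hr hs in r0 sn *.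
have [rs|sr] := leqP r s.
  by rewrite (card_ffun_slab_formula t hs) ?r0 // card_ord.
(* Now [H] has no [r]-subset. The slab is empty as well, since a sum over [H] is at most
   [t * #|H| = t * (r - 1)]. *)
have -> : s = r.-1 by have := card_stressed_ge hH; rewrite hr hs; lia.
rewrite prednK // subnn big1 => [|m _]; last by rewrite big_nil.
congr Posz; apply: eq_card0 => f; rewrite !inE ltnNge.
suff -> : (\sum_(i in H) f i <= t * r.-1)%N by rewrite andbF.
have -> : r.-1 = #|H| by have := card_stressed_ge hH; rewrite hr hs; lia.
by rewrite mulnC -sum_nat_const; apply: leq_sum => i _; rewrite -ltnS.
Qed.
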